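(* Consider the energy-harvesting model described in the context, with parameters $p\in(0,1)$, $\gamma>0$, $B>0$, $w\in\mathbb{N}$. Let $\pi^*(w)$ be an optimal look-ahead policy of the stationary form described in the context (uniform allocation $b_\tau/d_\tau$ when an arrival is observed at distance $d_\tau\ge 1$ in the window, and $a_\tau=\mathcal{A}(b_\tau)$ otherwise), and let $(\xi_j^* )_{j\ge1}$ be its induced sequence. Then: (i) $\Gamma^*=\mathcal{T}_\infty^*$, where $\mathcal{T}_\infty^*=\sup \mathcal{T}_\infty(x_1,x_2,\dots)$ over all admissible sequences $(x_j)_{j\ge1}$; (ii) $(\xi_j^* )_{j\ge1}$ is the unique maximizer of $\mathcal{T}_\infty$ over admissible sequences; (iii) $(\xi_j^* )_{j\ge1}$ is the unique sequence satisfying, for all $j\in\mathbb{N}$, $$\frac{1-p}{1+\gamma \xi_{j+1}^*}=\frac{1}{1+\gamma \xi_j^*}-\frac{p}{1+\frac{\gamma}{w}\left(B-\sum_{i=1}^{j}\xi_i^*\right)},\qquad\text{and}\qquad \sum_{j=1}^{\infty}\xi_j^*=B;$$ (iv) $(\xi_j^* )_{j\ge1}$ is a strictly decreasing sequence of positive numbers satisfying $\xi_j^*<\frac{1}{w}\left(B-\sum_{i=1}^{j}\xi_i^*\right)$ for every $j\in\mathbb{N}$.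
   Context: Model: a transmitter sends over an AWGN channel with constant gain $\gamma>0$ in discrete time slots $\tau\in\mathbb{N}$; the reward of sending energy $a$ in a slot is $\frac12\log_2(1+\gamma a)$. The transmitter has a battery of capacity $B>0$. Energy arrivals $E_1,E_2,\dots$ are i.i.d. with $\Pr(E_\tau=B)=p$, $\Pr(E_\tau=0)=1-p$, where $0<p<1$. The battery level satisfies $B_1=B$ (the optimal value does not depend on the initial level) and $B_\tau=\min\{B_{\tau-1}-A_{\tau-1}+E_\tau,\,B\}$, where the action $A_\tau$ (energy spent at time $\tau$) must satisfy $0\le A_\tau\le B_\tau$. The transmitter has look-ahead window $w\in\mathbb{N}$: at time $\tau$ it knows $E_1,\dots,E_{\tau+w}$ (and $B_1$), and a (look-ahead) policy $\pi(w)$ is a sequence of (possibly randomized) action functions $A_\tau=\mathcal{A}_\tau((E_t)_{t=1}^{\tau+w},B_1)$. Its $T$-horizon average throughput is $\Gamma_T^{\pi(w)}=\frac1T\mathbb{E}\sum_{\tau=1}^T\frac12\log_2(1+\gamma A_\tau)$, and $\Gamma^*=\sup_{\pi(w)}\liminf_{T\to\infty}\Gamma_T^{\pi(w)}$. An optimal policy exists that is deterministic, Markovian and stationary; for the Bernoulli arrivals it can be taken of the following form: let $d_\tau=\min\{t\in\{1,\dots,w\}:E_{\tau+t}=B\}$ if this set is nonempty and $d_\tau=0$ otherwise; then $a_\tau=b_\tau/d_\tau$ if $d_\tau\neq0$, and $a_\tau=\mathcal{A}(b_\tau)$ if $d_\tau=0$, for some fixed function $\mathcal{A}$ with $0\le\mathcal{A}(b)\le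 b$. The sequence induced by such a policy is $\xi_j^*=\mathcal{A}(b_j)$, where $b_1=B$ and $b_{j+1}=b_j-\xi_j^*$ (the energies spent after a full charge while no arrival is seen in the window). A nonnegative sequence $(x_j)_{j\ge1}$ is admissible if $\sum_j x_j\le B$. For an admissible sequence, $$\mathcal{T}_\infty(x_1,x_2,\dots)=\sum_{k=1}^{w}p^2(1-p)^{k-1}\frac{k}{2}\log_2\!\Big(1+\gamma\frac{B}{k}\Big)+\sum_{j=1}^{\infty}p(1-p)^{j+w-1}\frac12\log_2(1+\gamma x_j)+\sum_{k=1}^{\infty}p^2(1-p)^{k+w-1}\frac{w}{2}\log_2\!\Big(1+\gamma\frac{B-\sum_{j=1}^{k}x_j}{w}\Big).$$
   Formalization: In (iii), uniqueness is among nonnegative sequences (energies); over arbitrary reals it fails: for w=γ=1, p=1/2, B≈0.74 a second solution starts x_1≈2.17, x_2≈-0.66, with all later terms negative. *)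

(* Defs.v *)
From HB Require Import structures.
From mathcomp Require Import all_boot all_order all_algebra.
From mathcomp Require Import all_classical all_reals all_analysis.
Set Implicit Arguments. Unset Strict Implicit. Unset Printing Implicit Defensive.
Import Order.TTheory GRing.Theory Num.Theory.
Local Open Scope ring_scope.

Section EH.
Variable R : realType.

Definition log2 (x : R) : R := ln x / ln 2.

Definition reward (gam a : R) : R := 2^-1 * log2 (1 + gam * a).

(* Arrival patterns: e : nat -> bool, e t = true iff E_t = B (times t >= 1;
   e 0 is unused).  Energy arriving at time t: *)
Definition arrival (B : R) (e : nat -> bool) (t : nat) : R := if e t then B else 0.

(* A deterministic action rule: A tau e = energy spent at time tau (tau >= 1)
   given the arrival pattern e. *)
Definition detpol := nat -> (nat -> bool) -> R.

(* bat B A e n = B_{n+1}, the battery level at time n+1. *)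
Fixpoint bat (B : R) (A : detpol) (e : nat -> bool) (n : nat) : R :=
  match n with
  | 0 => B
  | m.+1 => Num.min (bat B A e m - A m.+1 e + arrival B e m.+2) B
  end.

Definition causal (w : nat) (A : detpol) : Prop :=
  forall tau (e e' : nat -> bool),
    (forall t, (1 <= t <= tau + w)%N -> e t = e' t) -> A tau e = A tau e'.

Definition feasible (B : R) (A : detpol) : Prop :=
  forall tau e, (1 <= tau)%N -> 0 <= A tau e <= bat B A e tau.-1.

Definition admissible_detpol (w : nat) (B : R) (A : detpol) : Prop :=
  causal w A /\ feasible B A.

(* extension of a finite pattern s = (E_1,...,E_n) to nat -> bool *)
Definition ext (s : seq bool) (t : nat) : bool :=
  if t is t'.+1 then nth false s t' else false.

Definition weight (p : R) (s : seq bool) : R :=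
  \prod_(b <- s) (if b then p else 1 - p).

(* T-horizon average throughput of a deterministic look-ahead policy:
   expectation over (E_1,...,E_{T+w}), which determine A_1..A_T. *)
Definition GammaT_det (p gam : R) (w : nat) (A : detpol) (T : nat) : R :=
  T%:R^-1 * \sum_(s : (T + w).-tuple bool)
     weight p s * \sum_(1 <= tau < T.+1) reward gam (A tau (ext s)).

(* A (possibly randomized) look-ahead policy: a random seed omega drawn from a
   probability space (Omega, P), independent of the arrivals, and for each
   seed an admissible deterministic look-ahead policy, measurable in the seed. *)
Definition randpol (w : nat) (B : R) {d : measure_display} {Omega : measurableType d}
  (A : Omega -> detpol) : Prop :=
  (forall om, admissible_detpol w B (A om)) /\
  (forall tau e, measurable_fun setT (fun om => A om tau e)).

Definition GammaT_rand (p gam : R) (w : nat) {d : measure_display}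
  {Omega : measurableType d} (P : probability Omega R) (A : Omega -> detpol)
  (T : nat) : \bar R :=
  (\int[P]_om (GammaT_det p gam w (A om) T)%:E)%E.

Definition Gamma_star (p gam B : R) (w : nat) : \bar R :=
  ereal_sup [set g | exists (d : measure_display) (Omega : measurableType d)
                        (P : probability Omega R) (A : Omega -> detpol),
                 randpol w B A /\ g = limn_einf (GammaT_rand p gam w P A)].

Definition dist (w : nat) (e : nat -> bool) (tau : nat) : nat :=
  head 0%N [seq t <- iota 1 w | e (tau + t)%N].

Definition stat_act (w : nat) (Af : R -> R) (e : nat -> bool) (tau : nat) (b : R) : R :=
  let d := dist w e tau in if d != 0%N then b / d%:R else Af b.

(* sbat = b_{n+1} under the stationary policy *)
Fixpoint sbat (w : nat) (B : R) (Af : R -> R) (e : nat -> bool) (n : nat) : R :=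
  match n with
  | 0 => B
  | m.+1 => Num.min (sbat w B Af e m - stat_act w Af e m.+1 (sbat w B Af e m)
                      + arrival B e m.+2) B
  end.

Definition stat_pol (w : nat) (B : R) (Af : R -> R) : detpol :=
  fun tau e => stat_act w Af e tau (sbat w B Af e tau.-1).

(* induced sequence, 0-indexed: xi k = xi^*_{k+1}; bseq k = b_{k+1} *)
Fixpoint bseq (B : R) (Af : R -> R) (k : nat) : R :=
  match k with 0 => B | m.+1 => bseq B Af m - Af (bseq B Af m) end.

Definition xi (B : R) (Af : R -> R) (k : nat) : R := Af (bseq B Af k).

(* Sequences are 0-indexed: x k stands for x_{k+1}. *)
Definition admissible_seq (B : R) (x : nat -> R) : Prop :=
  (forall k, 0 <= x k) /\ (\sum_(k <oo) (x k)%:E <= B%:E)%E.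

Definition Tinf (p gam B : R) (w : nat) (x : nat -> R) : \bar R :=
  ((\sum_(1 <= k < w.+1) p ^+ 2 * (1 - p) ^+ k.-1 * (k%:R / 2)
        * log2 (1 + gam * (B / k%:R)))%:E
   + \sum_(k <oo) (p * (1 - p) ^+ (k + w) * reward gam (x k))%:E
   + \sum_(m <oo) (p ^+ 2 * (1 - p) ^+ (m + w) * (w%:R / 2)
        * log2 (1 + gam * ((B - \sum_(i < m.+1) x i) / w%:R)))%:E)%E.

Definition Tstar (p gam B : R) (w : nat) : \bar R :=
  ereal_sup [set Tinf p gam B w x | x in admissible_seq B].

(* the recursion of (iii), for j = k+1 >= 1 *)
Definition xi_recursion (p gam B : R) (w : nat) (x : nat -> R) : Prop :=
  forall k, (1 - p) / (1 + gam * x k.+1)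
            = (1 + gam * x k)^-1
              - p / (1 + gam / w%:R * (B - \sum_(i < k.+1) x i)).

End EH.

(* Main.v *)
(* A policy that spends [x_j] in the [j]-th slot after a full charge while its
   window is empty, and shares the remaining energy evenly once an arrival is
   visible, chooses its action from two independent quantities only: the time since
   the last charge and the distance to the next visible arrival, both truncated
   geometric.  Its expected reward per slot therefore converges, and summing over the
   two laws gives T_inf(x).  Every admissible [x] is realized by such a policy, and
   the given optimal stationary policy is the one with [x = xi]; optimality thus says
   that [xi] maximizes T_inf.

   Strict concavity of the reward makes the maximizer unique.  Exchanging energy
   between two consecutive slots gives the recursion once all terms are positive.
   A zero term would force all later terms to vanish with energy left over, which a
   one-slot modification improves.  In the limit the recursion leaves no energy
   unspent, it is monotone in its first term, which gives uniqueness in (iii), and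
   [x_k >= L_k / w], where [L_k] is the energy left after slot [k], would make the
   sequence nondecreasing, which is the bound in (iv). *)

Require Import Defs.
From HB Require Import structures.
From mathcomp Require Import all_boot all_order all_algebra.
From mathcomp Require Import all_classical all_reals all_analysis.
From mathcomp Require Import ring lra.
Import Order.TTheory GRing.Theory Num.Theory.
Import numFieldNormedType.Exports.
Local Open Scope ring_scope.

(** * Expectations over finite Bernoulli patterns; laws of the age and of the visible distance *)

Section Bits.
Context {R : realType}.
Implicit Types (p : R) (f g : seq bool -> R).

Definition expect p n f : R := \sum_(s : n.-tuple bool) weight p s * f s.

Lemma expect0 p f : expect p 0 f = f [::].
Proof.
rewrite /expect (big_pred1 [tuple]); last by move=> s; apply/esym/eqP; exact: tuple0.
by rewrite /weight big_nil mul1r.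
Qed.

Lemma expectS p n f :
  expect p n.+1 f = p * expect p n (fun s => f (true :: s))
                  + (1 - p) * expect p n (fun s => f (false :: s)).
Proof.
rewrite /expect (reindex (fun bs : bool * n.-tuple bool => [tuple of bs.1 :: bs.2])) /=; last first.
  exists (fun s : n.+1.-tuple bool => (thead s, [tuple of behead s])).
    by case=> b s _ /=; congr pair; apply/val_inj.
  by move=> s _ /=; rewrite -tuple_eta.
rewrite -(pair_bigA _ (fun b (s : n.-tuple bool) => weight p (b :: s) * f (b :: s))) /=.
rewrite big_bool /= !big_distrr /=.
by congr (_ + _); apply: eq_bigr => s _; rewrite /weight big_cons mulrA.
Qed.

Lemma eq_expect p n f g : (forall s, size s = n -> f s = g s) ->
  expect p n f = expect p n g.
Proof. by move=> fg; apply: eq_bigr => s _; rewrite fg ?size_tuple. Qed.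

Lemma expectZ p n c f : expect p n (fun s => c * f s) = c * expect p n f.
Proof. by rewrite /expect big_distrr /=; apply: eq_bigr => s _; rewrite mulrCA. Qed.

Lemma expectD p n f g :
  expect p n (fun s => f s + g s) = expect p n f + expect p n g.
Proof. by rewrite /expect -big_split /=; apply: eq_bigr => s _; rewrite mulrDr. Qed.

Lemma expect_sum p n I (r : seq I) (F : I -> seq bool -> R) :
  expect p n (fun s => \sum_(i <- r) F i s) = \sum_(i <- r) expect p n (F i).
Proof.
rewrite /expect exchange_big /=; apply: eq_bigr => s _.
by rewrite big_distrr.
Qed.

Lemma expect_cst p n c : expect p n (fun=> c) = c.
Proof.
elim: n => [|n IH]; first by rewrite expect0.
by rewrite expectS IH -mulrDl addrCA subrr addr0 mul1r.
Qed.

Lemma expect_cat p m n f :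
  expect p (m + n) f = expect p m (fun s1 => expect p n (fun s2 => f (s1 ++ s2))).
Proof.
elim: m f => [|m IH] f; first by rewrite expect0.
by rewrite addSn !expectS !IH.
Qed.

(* Slot [n.+1] is [age e n] slots after the last full charge; the initial full
   battery counts as a charge at slot 1. *)
Fixpoint age (e : nat -> bool) (n : nat) : nat :=
  if n is m.+1 then if e m.+2 then 0%N else (age e m).+1 else 0%N.

Lemma ageS e n : age e n.+1 = if e n.+2 then 0%N else (age e n).+1.
Proof. by []. Qed.

Lemma eq_age e e' n : (forall t, (1 <= t <= n.+1)%N -> e t = e' t) ->
  age e n = age e' n.
Proof.
elim: n => //= n IH ee'; rewrite ee' ?leqnn //= IH // => t /andP[t1 tn].
by rewrite ee' // t1 leqW.
Qed.

Lemma ext_cat s1 s2 t :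
  ext (s1 ++ s2) t = if (t <= size s1)%N then ext s1 t else ext s2 (t - size s1).
Proof.
case: t => [|t] //=; rewrite nth_cat; case: ltnP => // h.
by rewrite subSn.
Qed.

(** Splitting off the last bit, an arrival resets the age and its absence increases the age by one.
    The remaining mass [(1 - p) ^+ n] is the event that the initial charge is still the latest
    one. *)
Lemma expect_age p n (h : nat -> R) :
  expect p n.+1 (fun s => h (age (ext s) n))
  = \sum_(j < n) p * (1 - p) ^+ j * h j + (1 - p) ^+ n * h n.
Proof.
elim: n h => [|n IH] h.
  by rewrite /= expect_cst big_ord0 expr0 mul1r add0r.
rewrite -addn1 expect_cat.
under eq_expect => s ss.
  rewrite expectS !expect0 !ageS !ext_cat ss ltnn subSnn /=.
  rewrite (@eq_age (ext (s ++ [:: false])) (ext s)); last first.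
    by move=> t /andP[_ tn]; rewrite ext_cat ss tn.
  over.
rewrite expectD expect_cst expectZ (IH (fun k => h k.+1)).
rewrite big_ord_recl expr0 mulr1 mulrDr big_distrr /= addrA; congr (_ + _ + _).
  by apply: eq_bigr => i _; rewrite /bump /= exprS; ring.
by rewrite exprS mulrA.
Qed.

Lemma dist0 e tau : dist 0 e tau = 0%N. Proof. by []. Qed.

Lemma distS w e tau : dist w.+1 e tau =
  if e tau.+1 then 1%N else
  if dist w e tau.+1 == 0%N then 0%N else (dist w e tau.+1).+1.
Proof.
rewrite /dist /= addn1; case: ifP => // _.
rewrite -[2%N]addn1 iotaDl filter_map.
rewrite (eq_filter (a2 := fun t => e (tau.+1 + t)%N)); last first.
  by move=> t /=; rewrite add1n addnS addSn.
case E: [seq _ <- _ | _] => [|a l] //=.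
have : a \in [seq t <- iota 1 w | e (tau.+1 + t)%N] by rewrite E inE eqxx.
by rewrite mem_filter mem_iota => /and3P[_]; case: a {E}.
Qed.

Lemma dist_le w e tau : (dist w e tau <= w)%N.
Proof.
by elim: w tau => // w IH tau; rewrite distS; do 2![case: ifP => // _]; rewrite ltnS.
Qed.

Lemma eq_dist w e e' tau tau' :
  (forall t, (1 <= t <= w)%N -> e (tau + t)%N = e' (tau' + t)%N) ->
  dist w e tau = dist w e' tau'.
Proof.
move=> ee'; rewrite /dist; congr head; apply: eq_in_filter => t.
by rewrite mem_iota add1n ltnS => /ee'.
Qed.

Lemma dist_pending w (e : nat -> bool) tau :
  (0 < w)%N -> e tau.+1 -> dist w e tau = 1%N.
Proof. by case: w => // w _ h; rewrite distS h. Qed.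

Lemma dist_widen w e tau : dist w e tau != 0%N ->
  dist w.+1 e tau = dist w e tau.
Proof.
elim: w tau => // w IH tau; rewrite distS (distS w.+1).
case: ifP => // _; case: ifP => // /negbT d0 _.
by rewrite (IH _ d0) (negPf d0).
Qed.

Lemma dist_next w (e : nat -> bool) tau : ~~ e tau.+1 -> dist w e tau != 0%N ->
  (1 < dist w e tau)%N /\ dist w e tau.+1 = (dist w e tau).-1.
Proof.
case: w => // w /negPf he; rewrite [dist _ _ tau]distS he.
case: ifP => // /negbT d0 _; split; first by rewrite ltnS lt0n.
by rewrite dist_widen.
Qed.

(** Sliding an empty window by one slot uncovers only its farthest slot, so an arrival first becomes
    visible at distance exactly [w]. *)
Lemma dist_fresh w (e : nat -> bool) tau : (0 < w)%N -> dist w e tau = 0%N ->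
  ~~ e tau.+1 /\ (dist w e tau.+1 = 0%N \/ dist w e tau.+1 = w).
Proof.
elim: w tau => // w IH tau _; rewrite [dist _ _ tau]distS.
case: ifP => // et; case: eqP => // d0 _; split=> //.
case: w IH d0 => [|w] IH d0.
  by rewrite distS dist0 /=; case: ifP; auto.
have [/negPf ne [] h] := IH _ isT d0; rewrite distS ne h /=; auto.
Qed.

Lemma expect_dist p w n (g : nat -> R) : (w <= n)%N ->
  expect p n (fun s => g (dist w (ext s) 0))
  = \sum_(d < w) p * (1 - p) ^+ d * g d.+1 + (1 - p) ^+ w * g 0%N.
Proof.
elim: w n g => [|w IH] n g wn.
  under eq_expect => s _ do rewrite dist0.
  by rewrite expect_cst big_ord0 add0r mul1r.
case: n wn => // n wn.
rewrite expectS.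
under eq_expect => s ss do rewrite distS /=.
under [X in _ + _ * X]eq_expect => s ss.
  rewrite distS /= (@eq_dist w _ (ext s) 1 0) ; last by move=> [|t].
  over.
rewrite expect_cst (IH n (fun d => g (if d == 0 then 0 else d.+1)%N)) //=.
rewrite big_ord_recl expr0 mulr1 mulrDr big_distrr /= addrA; congr (_ + _ + _).
  by apply: eq_bigr => i _; rewrite /bump /= exprS; ring.
by rewrite exprS mulrA.
Qed.

(** The age in slot [n.+1] reads the bits up to [n.+1] and the distance reads the next [w] bits.
    These blocks are disjoint, hence independent, and any further bits integrate out. *)
Lemma expect_age_dist p w n N (F : nat -> nat -> R) : (n.+1 + w <= N)%N ->
  expect p N (fun s => F (age (ext s) n) (dist w (ext s) n.+1))
  = let h j := \sum_(d < w) p * (1 - p) ^+ d * F j d.+1 + (1 - p) ^+ w * F j 0%N in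
    \sum_(j < n) p * (1 - p) ^+ j * h j + (1 - p) ^+ n * h n.
Proof.
move=> nN /=; pose h j := \sum_(d < w) p * (1 - p) ^+ d * F j d.+1 + (1 - p) ^+ w * F j 0%N.
rewrite -/(h n) (eq_bigr (fun j : 'I_n => p * (1 - p) ^+ j * h j)) //.
rewrite -(subnKC (leq_trans (leq_addr w n.+1) nN)) expect_cat.
rewrite -(expect_age p n h) /=; apply: eq_expect => s1 ss1.
rewrite /h -(@expect_dist p w (N - n.+1)); last by rewrite leq_subRL // (leq_trans _ nN) ?leq_addr.
apply: eq_expect => s2 ss2.
rewrite (@eq_age _ (ext s1)); last by move=> t /andP[_ tn]; rewrite ext_cat ss1 tn.
rewrite (@eq_dist w _ (ext s2) _ 0) // => t /andP[t1 tw].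
by rewrite ext_cat ss1 -ltnS ltnS leqNgt -addn1 leq_add2l t1 /= addKn.
Qed.

End Bits.

(** * The policy that realizes a given sequence, with its battery in closed form *)

Section ChargePolicy.
Context {R : realType}.
Variables (w : nat) (B : R) (x : nat -> R).
Hypothesis w_gt0 : (0 < w)%N.

Definition leftover m : R := B - \sum_(i < m) x i.

Lemma leftover0 : leftover 0 = B.
Proof. by rewrite /leftover big_ord0 subr0. Qed.

Lemma leftoverS m : leftover m.+1 = leftover m - x m.
Proof. by rewrite /leftover big_ord_recr /= opprD addrA. Qed.

(* [j] counts the slots since the last full charge and [d] is the distance to
   the next visible arrival (0 if there is none), so that this arrival ends a
   gap of length [j + d], out of which the first [j + d - w] slots were blind. *)
Definition charge_act (j d : nat) : R :=
  if d == 0%N then x j else leftover (j + d - w) / (minn (j + d) w)%:R.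

(** Once an arrival is visible the battery holds exactly the [d] equal shares still to be spent, so
    it is empty when the arrival comes. *)
Definition charge_bat (j d : nat) : R :=
  if d == 0%N then leftover j else d%:R * charge_act j d.

Lemma charge_bat0 d : (d <= w)%N -> charge_bat 0 d = B.
Proof.
rewrite /charge_bat /charge_act; case: eqP => [_|/eqP d0 dw]; first by rewrite leftover0.
rewrite add0n (minn_idPl dw); move: (dw); rewrite -subn_eq0 => /eqP ->.
by rewrite leftover0 mulrC divfK // pnatr_eq0.
Qed.

Definition state_act (e : nat -> bool) n := charge_act (age e n) (dist w e n.+1).
Definition state_bat (e : nat -> bool) n := charge_bat (age e n) (dist w e n.+1).

Hypothesis x_ge0 : forall k, 0 <= x k.
Hypothesis leftover_ge0 : forall m, 0 <= leftover m.

Lemma leftover_le m : leftover m <= B.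
Proof. by rewrite /leftover gerBl sumr_ge0. Qed.

Lemma charge_act_ge0 j d : 0 <= charge_act j d.
Proof. by rewrite /charge_act; case: ifP => // _; rewrite divr_ge0. Qed.

Lemma charge_act_le j d : charge_act j d <= charge_bat j d.
Proof.
rewrite /charge_bat /charge_act; case: eqP => [_|/eqP d0].
  by rewrite -subr_ge0 -leftoverS.
by rewrite ler_peMl ?divr_ge0 // ler1n lt0n.
Qed.

(** A share is the leftover divided by [minn (j + d) w], which is at least [d], so [d] shares do not
    exceed the leftover. Consequently the cap at [B] is inactive between arrivals. *)
Lemma charge_bat_le j d : (d <= w)%N -> charge_bat j d <= B.
Proof.
rewrite /charge_bat /charge_act; case: eqP => [_ _|/eqP d0 dw]; first exact: leftover_le.
have m0 : (0 < minn (j + d) w)%N by rewrite leq_min w_gt0 addn_gt0 (lt0n d) d0 orbT.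
rewrite mulrCA mulrC -[leRHS]mul1r ler_pM ?mulr_ge0 ?invr_ge0 ?leftover_le //.
by rewrite ler_pdivrMr ?ltr0n // mul1r ler_nat leq_min dw leq_addl.
Qed.

Lemma state_bat0 e : state_bat e 0 = B.
Proof. by rewrite /state_bat /= charge_bat0 ?dist_le. Qed.

(** One slot later the age is one larger and the distance one smaller; the gap length [j + d] is
    unchanged, and so is the share. *)
Lemma charge_bat_next j d : (1 < d)%N ->
  charge_bat j d - charge_act j d = charge_bat j.+1 d.-1.
Proof.
case: d => [|[|d]] //= _; rewrite /charge_bat /charge_act /= addSnnS.
by rewrite -[d.+2]addn1 natrD mulrDl mul1r addrK.
Qed.

Lemma charge_bat_fresh j d : d = 0%N \/ d = w ->
  charge_bat j 0 - charge_act j 0 = charge_bat j.+1 d.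
Proof.
rewrite [charge_bat j 0]/charge_bat /charge_act /= -leftoverS; case=> ->.
  by rewrite /charge_bat.
rewrite /charge_bat /charge_act -[w == 0]negbK -lt0n w_gt0 /= addnK.
by rewrite (minn_idPr (leq_addl _ _)) mulrC divfK // pnatr_eq0 -lt0n.
Qed.

Lemma state_batS e n :
  Num.min (state_bat e n - state_act e n + arrival B e n.+2) B = state_bat e n.+1.
Proof.
rewrite /state_bat /state_act /arrival ageS; case: ifP => [en|/negbT en].
  (* An arrival in the next slot is seen at distance 1, so the whole battery is spent and the refill
     is exactly [B]. *)
  rewrite dist_pending // charge_bat0 ?dist_le // /charge_bat /=.
  by rewrite mul1r subrr add0r minxx.
rewrite addr0.
have := charge_bat_le (age e n).+1 _ (dist_le w e n.+2).
have [d0|/eqP d0] := dist w e n.+1 =P 0%N; last first.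
  have [d1 ->] := dist_next _ _ _ en d0.
  by rewrite -charge_bat_next // => /min_idPl.
have [_ /charge_bat_fresh <-] := dist_fresh _ _ _ w_gt0 d0.
by rewrite d0 => /min_idPl.
Qed.

Definition charge_pol : detpol R :=
  fun tau e => if tau is n.+1 then state_act e n else 0.

Lemma bat_charge_pol e n : bat B charge_pol e n = state_bat e n.
Proof.
elim: n => [|n IH]; first by rewrite state_bat0.
by rewrite -state_batS /= IH.
Qed.

Lemma charge_pol_admissible : admissible_detpol w B charge_pol.
Proof.
split=> [[|n]|[|n]] // e.
  move=> e' ee' /=; rewrite /state_act (@eq_age e e').
    rewrite (@eq_dist w e e' _ n.+1) // => t /andP[t1 tw].
    by rewrite ee' // addn_gt0 /= leq_add2l.
  by move=> t /andP[t1 tn]; rewrite ee' // t1 (leq_trans tn) ?leq_addr.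
by move=> _; rewrite bat_charge_pol charge_act_ge0 charge_act_le.
Qed.

(** Expected reward at age [j], averaged over the truncated geometric distance. *)
Definition mean_reward p gam j : R :=
  \sum_(d < w) p * (1 - p) ^+ d * reward gam (charge_act j d.+1)
  + (1 - p) ^+ w * reward gam (charge_act j 0).

Lemma GammaT_det_state p gam A T : (forall e n, A n.+1 e = state_act e n) ->
  GammaT_det p gam w A T = T%:R^-1 * \sum_(n < T)
    (\sum_(j < n) p * (1 - p) ^+ j * mean_reward p gam j
     + (1 - p) ^+ n * mean_reward p gam n).
Proof.
move=> AE; rewrite /GammaT_det; congr (_ * _).
rewrite -[LHS]/(expect p (T + w)
  (fun s => \sum_(1 <= tau < T.+1) reward gam (A tau (ext s)))).
rewrite expect_sum big_add1 big_mkord; apply: eq_bigr => n _.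
under eq_expect => s _ do rewrite AE.
by rewrite (@expect_age_dist _ p w n _ (fun j d => reward gam (charge_act j d)))
  ?leq_add2r.
Qed.

End ChargePolicy.

(** * The given stationary policy as the charge policy of its induced sequence *)

Section StationaryPolicy.
Context {R : realType}.
Variables (w : nat) (B : R) (Af : R -> R).
Hypotheses (w_gt0 : (0 < w)%N) (B_ge0 : 0 <= B).
Hypothesis Af_bounds : forall b, 0 <= b <= B -> 0 <= Af b <= b.

Lemma leftover_xi k : leftover B (xi B Af) k = Defs.bseq B Af k.
Proof. by elim: k => [|k IH]; rewrite ?leftover0 // leftoverS IH. Qed.

Lemma bseq_bounds k : 0 <= Defs.bseq B Af k <= B.
Proof.
elim: k => [|k IH] /=; first by rewrite B_ge0 lexx.
have /andP[A0 Ab] := Af_bounds _ IH; case/andP: IH => _ bB.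
by rewrite subr_ge0 Ab (le_trans _ bB) // gerBl.
Qed.

Lemma xi_ge0 k : 0 <= xi B Af k.
Proof. by case/andP: (Af_bounds _ (bseq_bounds k)). Qed.

Lemma leftover_xi_ge0 k : 0 <= leftover B (xi B Af) k.
Proof. by rewrite leftover_xi; case/andP: (bseq_bounds k). Qed.

(** With a visible arrival the battery is [d] shares, so dividing it by [d] gives back the constant
    share of the charge policy. *)
Lemma stat_act_state e n :
  stat_act w Af e n.+1 (state_bat w B (xi B Af) e n) = state_act w B (xi B Af) e n.
Proof.
rewrite /stat_act /state_bat /state_act /charge_bat.
case: eqP => [->|/eqP d0] /=; first by rewrite leftover_xi.
by rewrite mulrC mulKf // pnatr_eq0.
Qed.

Lemma sbat_state e n : sbat w B Af e n = state_bat w B (xi B Af) e n.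
Proof.
elim: n => [|n IH]; first by rewrite state_bat0.
rewrite -(state_batS _ _ _ w_gt0 xi_ge0 leftover_xi_ge0).
by rewrite /= IH stat_act_state.
Qed.

Lemma stat_pol_state e n :
  stat_pol w B Af n.+1 e = state_act w B (xi B Af) e n.
Proof. by rewrite /stat_pol sbat_state stat_act_state. Qed.

End StationaryPolicy.

(** * Monotonicity of the reward and convergence of series *)

Section Throughput.
Local Open Scope classical_set_scope.
Context {R : realType}.
Implicit Types (u v : nat -> R).

Lemma reward_ge0 (gam a : R) : 0 <= gam -> 0 <= a -> 0 <= reward gam a.
Proof.
move=> gam0 a0; rewrite /reward /log2 mulr_ge0 // divr_ge0 ?ln_ge0 ?lerDl ?mulr_ge0 //.
Qed.

Lemma ler_reward (gam a b : R) : 0 <= gam -> 0 <= a -> a <= b ->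
  reward gam a <= reward gam b.
Proof.
move=> gam0 a0 ab; rewrite /reward /log2 ler_wpM2l // ler_wpM2r //.
  by rewrite invr_ge0 ln_ge0 // lerDl.
have b0 := le_trans a0 ab.
rewrite ler_ln ?posrE ?ltr_wpDr ?mulr_ge0 //.
by rewrite lerD2l ler_wpM2l.
Qed.

Lemma nneseries_series u : cvgn (series u) ->
  (\sum_(k <oo) (u k)%:E)%E = (limn (series u))%:E.
Proof.
move=> cu; rewrite -EFin_lim //; congr (lim (_ @ \oo)); apply/funext => n.
by rewrite /= seriesEnat /= sumEFin.
Qed.

Lemma geometric_dominated_cvg u (K q : R) : 0 <= q < 1 ->
  (forall n, 0 <= u n <= K * q ^+ n) -> cvgn (series u).
Proof.
move=> /andP[q0 q1] uK; apply: (@series_le_cvg _ u (geometric K q)).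
- by move=> n; case/andP: (uK n).
- by move=> n; case/andP: (uK n) => u0; apply: le_trans.
- by move=> n; case/andP: (uK n).
- by apply: is_cvg_geometric_series; rewrite ger0_norm.
Qed.

(* Summation by parts of [\sum_(d < m) \sum_(d <= k < m) u k]. *)
Lemma sum_tails u m : m%:R * series u m - \sum_(d < m) series u d
  = \sum_(k < m) k.+1%:R * u k.
Proof.
elim: m => [|m IH]; first by rewrite !big_ord0 mul0r subrr.
rewrite !big_ord_recr /= -IH seriesSr -natr1; ring.
Qed.

(** An index [k < w] lies in [k.+1] of the windows [j, ..., j + w - 1], and every later index lies
    in [w] of them. *)
Lemma cvg_sum_windows u w : cvgn (series u) ->
  (fun n => \sum_(j < n) \sum_(d < w) u (j + d)%N) @ \oo -->
  \sum_(k < w) k.+1%:R * u k + w%:R * (limn (series u) - series u w).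
Proof.
move=> cu.
rewrite (_ : _ + _ = \sum_(d < w) (limn (series u) - series u d)); last first.
  rewrite -sum_tails sumrB sumr_const card_ord -mulr_natl; ring.
rewrite (_ : (fun n => _) = fun n => \sum_(d < w) (series u (n + d)%N - series u d)).
  apply: cvg_big => [|d _]; first exact: add_continuous.
  apply: cvgB; last exact: cvg_cst.
  by rewrite (cvg_shiftn d (series u)).
apply/funext => n; rewrite exchange_big; apply: eq_bigr => d _ /=.
rewrite series_addn [in RHS]addrC addKr -[X in index_iota X _]add0n big_addn addnK big_mkord.
by [].
Qed.

End Throughput.

(** * Convergence of the average throughput to the objective *)

Section LongRunThroughput.
Local Open Scope classical_set_scope.
Context {R : realType}.
Variables (p gam B : R) (w : nat).
Hypotheses (p_gt0 : 0 < p) (p_lt1 : p < 1) (gam_gt0 : 0 < gam) (B_gt0 : 0 < B).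
Hypothesis w_gt0 : (0 < w)%N.
Implicit Types x : nat -> R.

Let p_ge0 : 0 <= p. Proof. exact: ltW. Qed.
Let gam_ge0 : 0 <= gam. Proof. exact: ltW. Qed.
Let B_ge0 : 0 <= B. Proof. exact: ltW. Qed.
Let q_ge0 : 0 <= 1 - p. Proof. by rewrite subr_ge0 ltW. Qed.
Let q_lt1 : 1 - p < 1. Proof. by rewrite gtrBl. Qed.

Definition blind_gain x k : R := p * (1 - p) ^+ (k + w) * reward gam (x k).

(** Contribution of the gaps of length [k + w + 1]: the first [k + 1] slots are blind and the last
    [w] share the rest. *)
Definition window_gain x k : R :=
  p ^+ 2 * (1 - p) ^+ (k + w) * w%:R * reward gam (leftover B x k.+1 / w%:R).

Definition gain x k := blind_gain x k + window_gain x k.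

(** Gaps of length at most [w] are visible from their start, so this term does not depend on the
    sequence. *)
Definition short_gap_gain : R :=
  \sum_(1 <= k < w.+1) p ^+ 2 * (1 - p) ^+ k.-1 * (k%:R / 2)
     * log2 (1 + gam * (B / k%:R)).

(* [gap_gain x D] is the contribution of a gap of length [D.+1] divided by the
   number [minn D.+1 w] of slots in which its end is visible. *)
Definition gap_gain x D : R := p ^+ 2 * (1 - p) ^+ D
  * reward gam (leftover B x (D.+1 - w) / (minn D.+1 w)%:R).

Section Admissible.
Variable x : nat -> R.
Hypotheses (x_ge0 : forall k, 0 <= x k) (x_left : forall m, 0 <= leftover B x m).

Let x_le k : x k <= B.
Proof.
apply: le_trans (leftover_le B x x_ge0 k).
by rewrite -subr_ge0 -leftoverS.
Qed.

Let share_le m n : leftover B x m / n%:R <= B.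
Proof.
case: n => [|n]; first by rewrite invr0 mulr0.
rewrite ler_pdivrMr // (le_trans (leftover_le B x x_ge0 m)) // ler_peMr //.
by rewrite ler1n.
Qed.

Let share_ge0 m n : 0 <= leftover B x m / n%:R.
Proof. by rewrite divr_ge0. Qed.

Lemma blind_gain_bounds k :
  0 <= blind_gain x k <= p * (1 - p) ^+ w * reward gam B * (1 - p) ^+ k.
Proof.
rewrite /blind_gain exprD; apply/andP; split.
  by apply: mulr_ge0; rewrite ?reward_ge0 ?mulr_ge0 ?exprn_ge0.
rewrite [leRHS](_ : _ = p * ((1 - p) ^+ k * (1 - p) ^+ w) * reward gam B); last by ring.
by rewrite ler_wpM2l ?ler_reward ?mulr_ge0 ?exprn_ge0.
Qed.

Lemma gap_gain_bounds k :
  0 <= gap_gain x k <= p ^+ 2 * reward gam B * (1 - p) ^+ k.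
Proof.
rewrite /gap_gain; apply/andP; split.
  by apply: mulr_ge0; rewrite ?reward_ge0 ?mulr_ge0 ?exprn_ge0.
rewrite [leRHS](_ : _ = p ^+ 2 * (1 - p) ^+ k * reward gam B); last by ring.
by rewrite ler_wpM2l ?ler_reward ?mulr_ge0 ?exprn_ge0.
Qed.

Lemma window_gainE k : window_gain x k = w%:R * gap_gain x (k + w).
Proof.
rewrite /window_gain /gap_gain -addSn addnK (minn_idPr (leq_addl _ _)).
ring.
Qed.

Lemma cvg_blind_gain : cvgn (series (blind_gain x)).
Proof. by apply: geometric_dominated_cvg blind_gain_bounds; rewrite q_ge0. Qed.

Lemma cvg_gap_gain : cvgn (series (gap_gain x)).
Proof. by apply: geometric_dominated_cvg gap_gain_bounds; rewrite q_ge0. Qed.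

Lemma cvg_window_gain : series (window_gain x) @ \oo -->
  w%:R * (limn (series (gap_gain x)) - series (gap_gain x) w).
Proof.
rewrite (_ : series (window_gain x) = fun n =>
    w%:R * (series (gap_gain x) (n + w)%N - series (gap_gain x) w)).
  apply: cvgMr; apply: cvgB; last exact: cvg_cst.
  by rewrite (cvg_shiftn w (series (gap_gain x))); exact: cvg_gap_gain.
apply/funext => n; rewrite series_addn [in RHS]addrC addKr.
rewrite -[X in index_iota X _]add0n big_addn addnK mulr_sumr.
by apply: eq_bigr => k _; rewrite window_gainE.
Qed.

Lemma short_gap_gainE : short_gap_gain = \sum_(k < w) k.+1%:R * gap_gain x k.
Proof.
rewrite /short_gap_gain big_add1 big_mkord; apply: eq_bigr => k _ /=.
have : (k < w)%N by [].
rewrite /gap_gain /reward -subn_eq0 => /eqP kw.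
rewrite kw leftover0 (minn_idPl (ltn_ord k)); ring.
Qed.

Lemma TinfE : Tinf p gam B w x = (short_gap_gain + limn (series (gain x)))%:E.
Proof.
have -> : limn (series (gain x))
          = limn (series (blind_gain x)) + limn (series (window_gain x)).
  rewrite -limD; [|exact: cvg_blind_gain|exact: cvgP cvg_window_gain].
  by congr (lim (_ @ \oo)); apply/funext => n; rewrite /series /= big_split.
rewrite !EFinD -!nneseries_series; first last.
- exact: cvg_blind_gain.
- exact: cvgP cvg_window_gain.
rewrite addeA /Tinf; congr (_ + _)%E.
apply: eq_eseriesr => k _; congr (_%:E).
by rewrite /window_gain /reward /leftover; ring.
Qed.

(** The expected reward of a single slot converges by the age law, and the average over slots
    inherits the limit by Cesàro. *)
Lemma cvg_GammaT A : (forall e n, A n.+1 e = state_act w B x e n) ->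
  GammaT_det p gam w A @ \oo --> short_gap_gain + limn (series (gain x)).
Proof.
move=> AE.
pose h := mean_reward w B x p gam.
(* Age [j] and distance [d.+1] belong to a gap of length [(j + d).+1], on which alone the share and
   the probability depend. *)
have hE j : p * (1 - p) ^+ j * h j
    = \sum_(d < w) gap_gain x (j + d) + blind_gain x j.
  rewrite /h /mean_reward /blind_gain mulrDr mulr_sumr; congr (_ + _).
    apply: eq_bigr => d _; rewrite /gap_gain /charge_act /= exprD addnS; ring.
  by rewrite /charge_act /= exprD; ring.
have cvg1 : (fun n => \sum_(j < n) p * (1 - p) ^+ j * h j) @ \oo -->
    short_gap_gain + limn (series (gain x)).
  under eq_fun do under eq_bigr do rewrite hE.
  under eq_fun do rewrite big_split /=.
  rewrite (_ : _ + _ = (short_gap_gain + w%:R *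
      (limn (series (gap_gain x)) - series (gap_gain x) w))
      + limn (series (blind_gain x))).
    apply: cvgD; first by rewrite short_gap_gainE; exact: cvg_sum_windows cvg_gap_gain.
    have := cvg_blind_gain; rewrite /series /=.
    by under eq_fun do rewrite big_mkord.
  rewrite -addrA; congr (_ + _); rewrite addrC -(cvg_lim _ cvg_window_gain) //.
  rewrite -limD; [|exact: cvg_blind_gain|exact: cvgP cvg_window_gain].
  by congr (lim (_ @ \oo)); apply/funext => n; rewrite /series /= big_split.
(* The term of the initial charge vanishes: up to the factor [p^-1] it is a finite sum of terms of
   convergent series. *)
have cvg2 : (fun n => (1 - p) ^+ n * h n) @ \oo --> 0.
  rewrite (_ : (fun n => _) = fun n => p^-1 *
      (\sum_(d < w) gap_gain x (n + d) + blind_gain x n)); last first.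
    by apply/funext => n; rewrite -hE -mulrA mulKf // gt_eqF.
  rewrite [X in _ --> X](_ : 0 = p^-1 * (\sum_(d < w) 0 + 0)); last first.
    by rewrite big1_eq addr0 mulr0.
  apply: cvgMr; apply: cvgD; last exact: cvg_series_cvg_0 cvg_blind_gain.
  apply: (cvg_big add_continuous) => d _.
  by rewrite (cvg_shiftn d (gap_gain x)); exact: cvg_series_cvg_0 cvg_gap_gain.
rewrite -cvg_shiftS.
have := cesaro (cvgD cvg1 cvg2); rewrite addr0 => /(_ _); apply: cvg_trans.
apply: near_eq_cvg; near=> n.
rewrite /= (GammaT_det_state _ _ _ _ _ _ _ AE) /arithmetic_mean /series /=.
by rewrite big_mkord.
Unshelve. all: by end_near.
Qed.

End Admissible.
End LongRunThroughput.

(** * Admissibility through partial sums, and lower bounds on the optimal throughput *)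

Section GammaStar.
Local Open Scope classical_set_scope.
Context {R : realType}.

Lemma admissible_seqP (B : R) x : admissible_seq B x <->
  (forall k, 0 <= x k) /\ (forall m, 0 <= leftover B x m).
Proof.
split=> -[x0 xB]; split=> //.
  move=> m; rewrite subr_ge0 -lee_fin; apply: le_trans xB.
  have := @nneseries_lim_ge R (fun k => (x k)%:E) xpredT 0 m.
  by rewrite sumEFin big_mkord; apply => n _ _; rewrite lee_fin.
apply: lime_le; first by apply: is_cvg_nneseries => n _ _; rewrite lee_fin.
by apply: nearW => n; rewrite sumEFin lee_fin big_mkord -subr_ge0 -/(leftover B x n).
Qed.

Lemma probability_integral_cst d (T : measurableType d) (P : probability T R) (c : R) :
  (\int[P]_t c%:E)%E = c%:E.
Proof. by rewrite integral_cst // [X in (_ * X)%E]probability_setT mule1. Qed.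

(** A deterministic policy is a randomized one whose seed lives on a one-point space. *)
Lemma Gamma_star_ge (p gam B : R) w (A : detpol R) (l : R) :
  admissible_detpol w B A -> GammaT_det p gam w A @ \oo --> l ->
  (l%:E <= Gamma_star p gam B w)%E.
Proof.
move=> admA cA.
have cl : (GammaT_det p gam w A T)%:E @[T --> \oo] --> l%:E.
  by apply: cvg_EFin => //; exact: nearW.
apply: ereal_sup_ubound => /=.
exists _, unit, (\d_tt), (fun=> A); split.
  by split=> // tau e; exact: measurable_cst.
rewrite -(cvg_limn_einf_sup cl).1; congr limn_einf; apply/funext => T.
by rewrite /GammaT_rand probability_integral_cst.
Qed.

End GammaStar.

(** * Strict concavity of the reward *)

Section Reward.
Context {R : realType}.
Variable gam : R.
Hypothesis gam_gt0 : 0 < gam.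
Implicit Types a b : R.

(* The derivative of [reward gam] at [a] is [unit_reward * slope a]. *)
Definition slope (a : R) : R := (1 + gam * a)^-1.

Let unit_gt0 a : 0 <= a -> 0 < 1 + gam * a.
Proof. by move=> a0; rewrite ltr_pwDl // mulr_ge0 // ltW. Qed.

Lemma slope0 : slope 0 = 1.
Proof. by rewrite /slope mulr0 addr0 invr1. Qed.

Lemma ltr_slope a b : 0 <= a -> 0 <= b -> (slope a < slope b) = (b < a).
Proof.
move=> a0 b0; rewrite /slope ltf_pV2 ?posrE ?unit_gt0 //.
by rewrite ltrD2l ltr_pM2l.
Qed.

Lemma slope_inj a b : 0 <= a -> 0 <= b -> slope a = slope b -> a = b.
Proof.
move=> a0 b0 ab; apply/eqP; rewrite eq_le !leNgt -(ltr_slope a b) // -(ltr_slope b a) //.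
by rewrite ab ltxx.
Qed.

Lemma cvg_slope T (F : set_system T) (FF : Filter F) (u : T -> R) (l : R) :
  0 <= l -> (u t @[t --> F] --> l)%classic ->
  (slope (u t) @[t --> F] --> slope l)%classic.
Proof.
move=> l0 cu; apply: cvgV; first by rewrite gt_eqF ?unit_gt0.
by apply: cvgD; [exact: cvg_cst|exact: cvgMr].
Qed.

Definition unit_reward : R := 2^-1 * gam / ln 2.

Lemma unit_reward_gt0 : 0 < unit_reward.
Proof. by rewrite divr_gt0 ?mulr_gt0 ?invr_gt0 ?ln_gt0 ?ltr1n ?ltr0n. Qed.

(** With [t] the ratio of [1 + gam * b] to [1 + gam * a], this is [1 + ln t < expR (ln t)] for [t]
    different from 1. *)
Lemma reward_tangent a b : 0 <= a -> 0 <= b -> a != b ->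
  reward gam b - reward gam a < unit_reward * slope a * (b - a).
Proof.
move=> a0 b0 ab; have a1 := unit_gt0 a a0; have b1 := unit_gt0 b b0.
rewrite /reward /log2 -mulrBr -mulrBl -ln_div ?posrE //.
have -> : unit_reward * slope a * (b - a)
    = 2^-1 * (((1 + gam * b) / (1 + gam * a) - 1) / ln 2).
  by rewrite /unit_reward /slope; field; rewrite !gt_eqF // ln_gt0 // ltr1n.
set t := (1 + gam * b) / _.
rewrite ltr_pM2l // ltr_pM2r ?invr_gt0 ?ln_gt0 ?ltr1n //.
have t0 : 0 < t by rewrite /t divr_gt0.
rewrite ltrBrDl -{2}(lnK t0) expR_gt1Dx // ln_eq0 //.
apply: contra ab => /eqP /divr1_eq /addrI /mulfI -> //.
by rewrite gt_eqF.
Qed.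

Lemma ler_reward_tangent a b : 0 <= a -> 0 <= b ->
  unit_reward * slope b * (b - a) <= reward gam b - reward gam a.
Proof.
move=> a0 b0; have [->|ba] := eqVneq b a; first by rewrite !subrr mulr0.
by have /ltW := reward_tangent _ _ b0 a0 ba; lra.
Qed.

(** Add the two tangent inequalities at the midpoint; their linear terms cancel. *)
Lemma reward_midpoint a b : 0 <= a -> 0 <= b ->
  reward gam a + reward gam b <= 2 * reward gam ((a + b) / 2)
  ?= iff (a == b).
Proof.
move=> a0 b0; have [->|ab] := eqVneq a b.
  apply/leifP; rewrite (_ : (b + b) / 2 = b); last by field.
  by rewrite mulr_natl mulr2n.
apply/leifP.
have m0 : 0 <= (a + b) / 2 by rewrite divr_ge0 ?addr_ge0.
have ma : (a + b) / 2 != a by apply: contra ab => /eqP h; apply/eqP; lra.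
have mb : (a + b) / 2 != b by apply: contra ab => /eqP h; apply/eqP; lra.
have := reward_tangent _ _ m0 a0 ma; have := reward_tangent _ _ m0 b0 mb.
set c := _ * slope _; set m := (a + b) / 2 => h1 h2.
have : c * (b - m) + c * (a - m) = 0 by rewrite /m; field.
lra.
Qed.

End Reward.

(** * Uniqueness of the maximizer and its first-order conditions *)

Section Maximizer.
Local Open Scope classical_set_scope.
Context {R : realType}.
Variables (p gam B : R) (w : nat).
Hypotheses (p_gt0 : 0 < p) (p_lt1 : p < 1) (gam_gt0 : 0 < gam) (B_gt0 : 0 < B).
Hypothesis w_gt0 : (0 < w)%N.

Let p_ge0 : 0 <= p. Proof. exact: ltW. Qed.
Let q_gt0 : 0 < 1 - p. Proof. by rewrite subr_gt0. Qed.
Let q_ge0 : 0 <= 1 - p. Proof. exact: ltW. Qed.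
Let wR_gt0 : 0 < w%:R :> R. Proof. by rewrite ltr0n. Qed.

Local Notation gain := (gain p gam B w).
Local Notation slope := (slope gam).
Local Notation kappa := (unit_reward gam).

Definition feasible_seq (x : nat -> R) :=
  (forall k, 0 <= x k) /\ (forall m, 0 <= leftover B x m).

(** Stationarity: energy spent in a blind slot has the same marginal value as energy kept, which is
    shared over the window with probability [p] and otherwise available in the next blind slot. *)
Definition balanced x := forall k, (1 - p) * slope (x k.+1)
  = slope (x k) - p * slope (leftover B x k.+1 / w%:R).

Definition maximizer x := feasible_seq x /\
  forall y, feasible_seq y -> limn (series (gain y)) <= limn (series (gain x)).

Lemma cvg_gain x : feasible_seq x -> cvgn (series (gain x)).
Proof.
case=> x0 xl; rewrite (_ : series _ = series (blind_gain p gam w x)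
    \+ series (window_gain p gam B w x)); last first.
  by apply/funext => n; rewrite /series /= big_split.
apply: is_cvgD; first exact: cvg_blind_gain.
by apply: cvgP; apply: cvg_window_gain.
Qed.

(** Turns a gain computed on partial sums into a bound on the limits, so that a local modification
    can be tested against optimality. *)
Lemma maximizer_gap x y N c : maximizer x -> feasible_seq y ->
  (forall n, (N <= n)%N -> c <= series (gain y) n - series (gain x) n) -> c <= 0.
Proof.
move=> [fx mx] fy cn; rewrite -(lerD2l (limn (series (gain x)))) addr0.
apply: le_trans (mx y fy); rewrite -lerBrDl -limB; [|exact: cvg_gain..].
apply: limr_ge; first by apply: is_cvgB; exact: cvg_gain.
by near=> n; apply: cn; near: n; exact: nbhs_infty_ge.
Unshelve. all: by end_near.
Qed.

Definition blend (x y : nat -> R) k := (x k + y k) / 2.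

Lemma leftover_blend x y m :
  leftover B (blend x y) m = (leftover B x m + leftover B y m) / 2.
Proof.
elim: m => [|m IH]; first by rewrite !leftover0; field.
by rewrite !leftoverS IH /blend; field.
Qed.

(** Both parts of the gain are concave; strictness is taken from the blind part, which involves
    [x k] directly. *)
Lemma gain_blend x y k : feasible_seq x -> feasible_seq y ->
  gain x k + gain y k <= 2 * gain (blend x y) k /\
  (x k != y k -> gain x k + gain y k < 2 * gain (blend x y) k).
Proof.
move=> [x0 xl] [y0 yl].
have share0 z m : feasible_seq z -> 0 <= leftover B z m / w%:R.
  by case=> _ zl; rewrite divr_ge0 // ltW.
have bm := reward_midpoint _ gam_gt0 _ _ (x0 k) (y0 k).
have wm := reward_midpoint _ gam_gt0 _ _ (share0 _ k.+1 (conj x0 xl)) (share0 _ k.+1 (conj y0 yl)).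
have a_gt0 : 0 < p * (1 - p) ^+ (k + w) by rewrite mulr_gt0 ?exprn_gt0.
have b_gt0 : 0 < p ^+ 2 * (1 - p) ^+ (k + w) * w%:R by rewrite !mulr_gt0 ?exprn_gt0.
have E : 2 * gain (blend x y) k - (gain x k + gain y k)
   = p * (1 - p) ^+ (k + w) * (2 * reward gam ((x k + y k) / 2)
        - (reward gam (x k) + reward gam (y k)))
   + p ^+ 2 * (1 - p) ^+ (k + w) * w%:R *
     (2 * reward gam ((leftover B x k.+1 / w%:R + leftover B y k.+1 / w%:R) / 2)
        - (reward gam (leftover B x k.+1 / w%:R) + reward gam (leftover B y k.+1 / w%:R))).
  rewrite /gain /blind_gain /window_gain leftover_blend -mulrDl [_ / 2 / _]mulrAC.
  rewrite -/(blend x y k); ring.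
split=> [|xy].
  rewrite -subr_ge0 E; apply: addr_ge0; apply: mulr_ge0;
    rewrite ?subr_ge0 ?(ltW a_gt0) ?(ltW b_gt0) //.
    exact: bm.1.
  exact: wm.1.
rewrite -subr_gt0 E ltr_pwDl //.
  by rewrite mulr_gt0 // subr_gt0 (lt_leif bm) xy.
by rewrite mulr_ge0 ?(ltW b_gt0) // subr_ge0; exact: wm.1.
Qed.

Lemma maximizer_unique x y : maximizer x -> maximizer y -> x = y.
Proof.
move=> mx my; apply/funext => k; apply/eqP/negPn/negP => xy.
have [fx _] := mx; have [fy _] := my.
have fz : feasible_seq (blend x y).
  case: fx fy => x0 xl [y0 yl]; split=> m.
    by rewrite divr_ge0 ?addr_ge0.
  by rewrite leftover_blend divr_ge0 // (addr_ge0 (xl m) (yl m)).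
have xyE : limn (series (gain x)) = limn (series (gain y)).
  by apply/eqP; rewrite eq_le mx.2 // my.2.
(* A single index where the sequences differ already gives the midpoint a fixed advantage [c]; all
   other terms are nonnegative. *)
pose c := 2 * gain (blend x y) k - (gain x k + gain y k).
have c_gt0 : 0 < c by rewrite subr_gt0; apply: (gain_blend _ _ _ fx fy).2.
have : 2 * limn (series (gain (blend x y)))
    - (limn (series (gain x)) + limn (series (gain y))) >= c.
  have cv : series (fun k => 2 * gain (blend x y) k - (gain x k + gain y k)) @ \oo -->
     2 * limn (series (gain (blend x y)))
      - (limn (series (gain x)) + limn (series (gain y))).
    rewrite (_ : series _ = fun n => 2 * series (gain (blend x y)) n
        - (series (gain x) n + series (gain y) n)); last first.
      by apply/funext => n; rewrite /series /= sumrB big_split mulr_sumr.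
    apply: cvgB; first by apply: cvgMr; exact: cvg_gain.
    by apply: cvgD; exact: cvg_gain.
  rewrite -(cvg_lim _ cv) //; apply: limr_ge; first exact: cvgP cv.
  near=> n; have kn : (k < n)%N by near: n; exact: nbhs_infty_gt.
  rewrite /series /= big_mkord (bigD1 (Ordinal kn)) //= lerDl.
  by apply: sumr_ge0 => i _; rewrite subr_ge0 (gain_blend _ _ _ fx fy).1.
have := mx.2 _ fz; rewrite -xyE; lra.
Unshelve. all: by end_near.
Qed.

Let alpha_gt0 k : 0 < p * (1 - p) ^+ (k + w).
Proof. by rewrite mulr_gt0 ?exprn_gt0. Qed.
Let beta_gt0 k : 0 < p ^+ 2 * (1 - p) ^+ (k + w) * w%:R.
Proof. by rewrite !mulr_gt0 ?exprn_gt0. Qed.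

(** * Perturbations of a maximizer: positivity and the balance equation *)

Section Perturbation.
Variable x : nat -> R.
Hypothesis mx : maximizer x.

Let x_ge0 k : 0 <= x k. Proof. by case: mx => -[]. Qed.
Let x_left m : 0 <= leftover B x m. Proof. by case: mx => -[]. Qed.

Definition shift k (e : R) i : R :=
  x i + (if i == k then e else 0) - (if i == k.+1 then e else 0).

Lemma leftover_shift k e m :
  leftover B (shift k e) m = leftover B x m - (if m == k.+1 then e else 0).
Proof.
elim: m => [|m IH]; first by rewrite !leftover0 subr0.
by rewrite !leftoverS IH /shift eqSS; ring.
Qed.

(* Moving energy [e] from slot [k.+1] to slot [k] only changes two blind gains and
   one window gain; each is bounded below by its tangent at the new point. *)
Lemma marginal_exchange k e : - x k <= e -> e <= x k.+1 ->
  e * (slope (x k + e) - (1 - p) * slope (x k.+1 - e)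
       - p * slope ((leftover B x k.+1 - e) / w%:R)) <= 0.
Proof.
move=> xe ex.
have fy : feasible_seq (shift k e).
  split=> m; rewrite ?leftover_shift /shift.
    case: eqP => [->|_]; last case: eqP => [->|_].
    - by rewrite ltn_eqF // subr0 -lerBlDl sub0r.
    - by rewrite addr0 subr_ge0.
    - by rewrite addr0 subr0.
  case: eqP => [->|_]; last by rewrite subr0.
  by rewrite subr_ge0 (le_trans ex) // -subr_ge0 -leftoverS.
pose D i := gain (shift k e) i - gain x i.
have D0 i : i != k -> i != k.+1 -> D i = 0.
  move=> /negPf ik /negPf ik1.
  by rewrite /D /gain /blind_gain /window_gain leftover_shift /shift eqSS ik ik1 addr0 !subr0 subrr.
have L0 : 0 <= leftover B x k.+1 - e.
  by have := fy.2 k.+1; rewrite leftover_shift eqxx.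
have xe0 : 0 <= x k + e by rewrite -lerBlDl sub0r.
have xe1 : 0 <= x k.+1 - e by rewrite subr_ge0.
have Dk : p * (1 - p) ^+ (k + w) * (kappa * slope (x k + e) * e)
    - p ^+ 2 * (1 - p) ^+ (k + w) * (kappa * slope ((leftover B x k.+1 - e) / w%:R) * e)
    <= D k.
  rewrite /D /gain /blind_gain /window_gain leftover_shift /shift !eqxx ltn_eqF // subr0.
  have T1 := ler_reward_tangent _ gam_gt0 _ _ (x_ge0 k) xe0.
  have T2 := ler_reward_tangent _ gam_gt0 _ _ (divr_ge0 (x_left k.+1) (ltW wR_gt0))
            (divr_ge0 L0 (ltW wR_gt0)).
  move: (ler_wpM2l (ltW (alpha_gt0 k)) T1) (ler_wpM2l (ltW (beta_gt0 k)) T2).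
  set r1 := reward _ (x k + e); set r2 := reward _ (x k).
  set r3 := reward _ ((leftover B x k.+1 - e) / w%:R).
  set r4 := reward _ (leftover B x k.+1 / w%:R) => h1 h2.
  (* The factor [w] in the weight cancels the division of [e] by [w] in the share. *)
  rewrite [leLHS](_ : _ = p * (1 - p) ^+ (k + w) * (kappa * slope (x k + e) * (x k + e - x k))
    + p ^+ 2 * (1 - p) ^+ (k + w) * w%:R *
     (kappa * slope ((leftover B x k.+1 - e) / w%:R)
      * ((leftover B x k.+1 - e) / w%:R - leftover B x k.+1 / w%:R))); last first.
    by field; rewrite gt_eqF.
  rewrite [leRHS](_ : _ = p * (1 - p) ^+ (k + w) * (r1 - r2)
    + p ^+ 2 * (1 - p) ^+ (k + w) * w%:R * (r3 - r4)); last by ring.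
  exact: lerD.
have Dk1 : - (p * (1 - p) ^+ (k.+1 + w) * (kappa * slope (x k.+1 - e) * e)) <= D k.+1.
  rewrite /D /gain /blind_gain /window_gain leftover_shift /shift !eqxx gtn_eqF //.
  rewrite eqSS gtn_eqF // subr0 addr0 opprD addrACA subrr addr0 -mulrBr.
  have := ler_reward_tangent _ gam_gt0 _ _ (x_ge0 k.+1) xe1.
  rewrite (_ : x k.+1 - e - x k.+1 = - e) ?mulrN; last by ring.
  by move=> /(ler_wpM2l (ltW (alpha_gt0 k.+1))); rewrite mulrN.
have : kappa * p * (1 - p) ^+ (k + w) * (e * (slope (x k + e)
     - (1 - p) * slope (x k.+1 - e)
     - p * slope ((leftover B x k.+1 - e) / w%:R))) <= 0.
  apply: (@maximizer_gap x (shift k e) k.+2 _ mx fy) => n kn.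
  rewrite /series /= -sumrB big_mkord.
  rewrite (bigD1 (Ordinal (ltnW kn))) // (bigD1 (Ordinal kn)) ?gtn_eqF //=; last first.
    by rewrite -val_eqE /= gtn_eqF.
  rewrite big1 ?addr0; last by move=> i /andP[ik ik1]; rewrite -/(D i) D0.
  rewrite -/(D k) -/(D k.+1).
  apply: le_trans (lerD Dk Dk1); rewrite le_eqVlt; apply/orP; left; apply/eqP.
  rewrite addSn (exprS _ (k + w)); ring.
rewrite pmulr_rle0 // -mulrA; apply: mulr_gt0 => //; exact: unit_reward_gt0.
Qed.

Let gap k e := slope (x k + e) - (1 - p) * slope (x k.+1 - e)
       - p * slope ((leftover B x k.+1 - e) / w%:R).

Let gap_continuous k : gap k e @[e --> 0] --> gap k 0.
Proof.
apply: cvgB; first apply: cvgB.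
- apply: (@cvg_slope _ _ gam_gt0 _ _ _ (fun e => x k + e) (x k + 0)); first by rewrite addr0.
  by apply: cvgD; [exact: cvg_cst|exact: cvg_id].
- apply: cvgMr; apply: (@cvg_slope _ _ gam_gt0 _ _ _ (fun e => x k.+1 - e) (x k.+1 - 0)).
    by rewrite subr0.
  by apply: cvgB; [exact: cvg_cst|exact: cvg_id].
- apply: cvgMr; apply: (@cvg_slope _ _ gam_gt0 _ _ _ (fun e => (leftover B x k.+1 - e) / w%:R)
    ((leftover B x k.+1 - 0) / w%:R)).
    by rewrite subr0 divr_ge0 // ltW.
  by apply: cvgMl; apply: cvgB; [exact: cvg_cst|exact: cvg_id].
Qed.

(** If this failed, continuity would make a small transfer from slot [k.+1] to slot [k] profitable;
    positivity of [x k.+1] makes the transfer affordable. The reverse bound uses a negative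
    transfer. *)
Lemma marginal_next_le k : 0 < x k.+1 ->
  slope (x k) <= (1 - p) * slope (x k.+1) + p * slope (leftover B x k.+1 / w%:R).
Proof.
move=> xk; rewrite -subr_ge0 leNgt; apply/negP => lt0.
have : 0 < gap k 0 by rewrite /gap addr0 !subr0; move: lt0; lra.
move/(cvgr_gt _ (gap_continuous k)) => /nbhs_ballP [r r0 hr].
pose e := Num.min (r / 2) (x k.+1).
have e0 : 0 < e by rewrite lt_min xk divr_gt0.
have : 0 < gap k e.
  apply: hr; rewrite /ball /= sub0r normrN gtr0_norm //.
  by rewrite gt_min ltr_pdivrMr // mulr_natr mulr2n ltrDl r0.
have := marginal_exchange k e; rewrite -/(gap k e) pmulr_rle0 // ge_min lexx orbT.
rewrite (le_trans _ (ltW e0)) ?oppr_le0 // => /(_ isT isT).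
by rewrite leNgt => /negP.
Qed.

Lemma marginal_next_ge k : 0 < x k ->
  (1 - p) * slope (x k.+1) + p * slope (leftover B x k.+1 / w%:R) <= slope (x k).
Proof.
move=> xk; rewrite -subr_ge0 leNgt; apply/negP => lt0.
have : gap k 0 < 0 by rewrite /gap addr0 !subr0; move: lt0; lra.
move/(cvgr_lt _ (gap_continuous k)) => /nbhs_ballP [r r0 hr].
pose e := - Num.min (r / 2) (x k).
have e0 : e < 0 by rewrite oppr_lt0 lt_min xk divr_gt0.
have : gap k e < 0.
  apply: hr; rewrite /ball /= sub0r normrN ltr0_norm // opprK.
  by rewrite gt_min ltr_pdivrMr // mulr_natr mulr2n ltrDl r0.
have := marginal_exchange k e; rewrite -/(gap k e) nmulr_rle0 // lerN2 ge_min lexx orbT.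
rewrite (le_trans (ltW e0)) // => /(_ isT isT).
by rewrite leNgt => /negP.
Qed.

Definition raise K (e : R) i : R := x i + (if i == K then e else 0).

Lemma leftover_raise K e m :
  leftover B (raise K e) m = leftover B x m - (if (K < m)%N then e else 0).
Proof.
elim: m => [|m IH]; first by rewrite !leftover0 subr0.
rewrite !leftoverS IH /raise ltnS [(K <= m)%N]leq_eqVlt [m == K]eq_sym.
by case: eqP => [->|_] /=; rewrite ?ltnn; ring.
Qed.

Lemma geometric_tail K n :
  \sum_(i < n) p * (1 - p) ^+ (K + i) = (1 - p) ^+ K * (1 - (1 - p) ^+ n).
Proof.
elim: n => [|n IH]; first by rewrite big_ord0 expr0 subrr mulr0.
by rewrite big_ord_recr /= IH exprD exprS; ring.
Qed.

(* If [x] stopped at [K] with energy left, spending at [K] the share that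
   equalizes slot [K] with the [w] slots of every later window would pay off. *)
Lemma maximizer_no_slack K : (forall i, (K <= i)%N -> x i = 0) -> leftover B x K <= 0.
Proof.
move=> xK; rewrite leNgt; apply/negP => L_gt0.
set L := leftover B x K in L_gt0.
have LE m : (K <= m)%N -> leftover B x m = L.
  move=> /subnKC <-; elim: (m - K)%N => [|i IH]; first by rewrite addn0.
  by rewrite addnS leftoverS IH xK ?subr0 ?leq_addr.
pose e := L / (w%:R + 1).
have w1 : 0 < w%:R + 1 :> R by rewrite addr_gt0.
have e0 : 0 < e by rewrite divr_gt0.
have wE : (L - e) / w%:R = e by rewrite /e; field; rewrite !gt_eqF.
have eL : e < L / w%:R.
  by rewrite -wE ltr_pM2r ?invr_gt0 // gtrBl.
have fy : feasible_seq (raise K e).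
  split=> m; first by rewrite addr_ge0 //; case: ifP => // _; exact: ltW.
  rewrite leftover_raise; case: ifP => [Km|_]; last by rewrite subr0.
  by rewrite LE 1?ltnW // -[L - e](divfK (lt0r_neq0 wR_gt0)) wE mulr_ge0 // ltW.
set r := reward gam e; set r' := reward gam (L / w%:R).
have rr' : r <= r' by apply: ler_reward; rewrite ltW.
(* Both sides are compared with the tangent at [e]: since [w * (L / w - e) = e], the two linear
   bounds coincide. *)
have r_gt : w%:R * (r' - r) < r.
  have h1 : r' - r < kappa * slope e * (L / w%:R - e).
    by apply: reward_tangent => //; rewrite ?divr_ge0 ?(ltW e0) ?(ltW L_gt0) ?lt_eqF // ltW.
  have h2 := ler_reward_tangent _ gam_gt0 _ _ (lexx 0) (ltW e0).
  have r0 : reward gam 0 = 0 by rewrite /reward /log2 mulr0 addr0 ln1 mul0r mulr0.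
  rewrite r0 !subr0 in h2; apply: lt_le_trans h2.
  rewrite mulrC -ltr_pdivlMr //; apply: lt_le_trans h1 _.
  rewrite le_eqVlt; apply/orP; left; apply/eqP; rewrite /e; field.
  by rewrite !gt_eqF.
(* Immediate gain at [K] minus a bound on the losses in all later windows, whose geometric weights
   sum to at most [(1 - p) ^+ K]. *)
pose c := p * (1 - p) ^+ (K + w) * (r - w%:R * (r' - r)).
have c_gt0 : 0 < c by rewrite mulr_gt0 // subr_gt0.
suff : c <= 0 by rewrite leNgt c_gt0.
apply: (@maximizer_gap x (raise K e) K.+1 _ mx fy) => n Kn.
pose D i := gain (raise K e) i - gain x i.
have D_lt i : (i < K)%N -> D i = 0.
  move=> iK; rewrite /D /gain /blind_gain /window_gain leftover_raise /raise ltnS.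
  by rewrite leqNgt iK (ltn_eqF iK) addr0 subr0 subrr.
have D_ge i : (K <= i)%N ->
    D i = (if i == K then p * (1 - p) ^+ (K + w) * r else 0)
      - p * (1 - p) ^+ w * w%:R * (r' - r) * (p * (1 - p) ^+ i).
  move=> Ki; rewrite /D /gain /blind_gain /window_gain leftover_raise /raise ltnS Ki.
  rewrite (LE i.+1) 1?leqW // wE -/r -/r' (xK _ Ki) exprD.
  have r0 : reward gam 0 = 0 by rewrite /reward /log2 mulr0 addr0 ln1 mul0r mulr0.
  by case: eqP => [->|_]; rewrite ?addr0 ?add0r ?r0 -/r ?exprD; ring.
rewrite /series /= -sumrB (big_cat_nat (leq0n K) (ltnW Kn)) /=.
rewrite big_nat big1 ?add0r; last by move=> i /andP[_ /D_lt].
rewrite (eq_big_nat _ _ (F2 := fun i => (if i == K then p * (1 - p) ^+ (K + w) * r else 0)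
      - p * (1 - p) ^+ w * w%:R * (r' - r) * (p * (1 - p) ^+ i))); last first.
  by move=> i /andP[/D_ge].
rewrite sumrB -mulr_sumr (bigD1_seq K) ?iota_uniq ?mem_index_iota ?leqnn //= eqxx.
rewrite big1_seq ?addr0; last by move=> i /andP[/negPf ->].
rewrite -[X in index_iota X n]add0n big_addn big_mkord.
under eq_bigr do rewrite addnC.
rewrite geometric_tail /c exprD -subr_ge0.
rewrite [leRHS](_ : _ = p * (1 - p) ^+ w * w%:R * (r' - r)
   * (1 - p) ^+ K * (1 - p) ^+ (n - K)); last by ring.
have rr0 : 0 <= r' - r by rewrite subr_ge0.
by rewrite !(mulr_ge0, rr0, exprn_ge0) // ltW.
Qed.

Lemma maximizer_gt0 k : 0 < x k.
Proof.
have [//|xk] := ltP 0 (x k).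
have exk : exists i, x i == 0 by exists k; rewrite eq_le xk x_ge0.
case: (ex_minnP exk) => K /eqP xK0 minK.
have slope_lt1 a : 0 < a -> slope a < 1.
  by move=> a0; rewrite -(slope0 gam) ltr_slope // ltW.
have slope_le1 a : 0 <= a -> slope a <= 1.
  rewrite le_eqVlt => /predU1P[<-|/slope_lt1/ltW //].
  by rewrite slope0.
(* After a zero, where the slope is 1, a positive term would make the right-hand side of
   [marginal_next_le] less than 1. *)
have xK i : (K <= i)%N -> x i = 0.
  move=> /subnKC <-; elim: (i - K)%N => [|j IH]; first by rewrite addn0.
  apply/eqP; rewrite addnS eq_le x_ge0 andbT leNgt; apply/negP => xj.
  have := marginal_next_le _ xj; rewrite IH slope0 leNgt => /negP; apply.
  rewrite [ltRHS](_ : 1 = (1 - p) * 1 + p * 1); last by ring.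
  apply: ltr_leD; first by rewrite ltr_pM2l // slope_lt1.
  by rewrite ler_pM2l // slope_le1 // divr_ge0 // ltW.
have LK : leftover B x K = 0.
  by apply/eqP; rewrite eq_le x_left andbT maximizer_no_slack.
(* A first zero at index 0 would leave [B] unspent. Otherwise the leftover and the next term both
   vanish after the positive [x K], and [marginal_next_ge] forces its slope up to 1. *)
case: K => [|K] in xK0 minK xK LK *; first by move: B_gt0; rewrite -LK leftover0 ltxx.
have xK' : 0 < x K.
  by rewrite lt_neqAle x_ge0 andbT eq_sym; apply/negP => /minK; rewrite ltnn.
have := marginal_next_ge _ xK'; rewrite LK xK0 mul0r slope0 !mulr1 subrK.
by rewrite leNgt slope_lt1.
Qed.

Lemma maximizer_balanced : balanced x.
Proof.
move=> k.
apply/eqP; rewrite -subr_eq0 opprB addrA subr_eq0 eq_le.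
by rewrite marginal_next_ge ?marginal_next_le // maximizer_gt0.
Qed.

End Perturbation.

(** * Consequences of the balance equation *)

Section Recursion.
Variable x : nat -> R.
Hypothesis fx : feasible_seq x.
Hypothesis x_rec : balanced x.

Let x_ge0 k : 0 <= x k. Proof. by case: fx. Qed.
Let x_left m : 0 <= leftover B x m. Proof. by case: fx. Qed.
Let share_ge0 m : 0 <= leftover B x m / w%:R. Proof. by rewrite divr_ge0 // ltW. Qed.

Lemma x_le_leftover k : x k <= leftover B x k.
Proof. by rewrite -subr_ge0 -leftoverS. Qed.

(** The leftover decreases to some [s], so the terms tend to 0. The recursion becomes
    [1 - p = 1 - p * slope (s / w)] in the limit, whence [s = 0]. *)
Lemma cvg_leftover : leftover B x @ \oo --> 0.
Proof.
have cl : cvgn (leftover B x).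
  apply: nonincreasing_is_cvgn.
    by apply/nonincreasing_seqP => n; rewrite leftoverS gerBl.
  by exists 0 => _ [n _ <-].
set s : R := limn (leftover B x).
have s_ge0 : 0 <= s by apply: limr_ge => //; exact: nearW.
have clS : leftover B x k.+1 @[k --> \oo] --> s by rewrite (cvg_shiftS (leftover B x)).
have cx : x @ \oo --> 0.
  rewrite (_ : x = fun k => leftover B x k - leftover B x k.+1).
    by rewrite -(subrr s); apply: cvgB.
  by apply/funext => k; rewrite leftoverS subKr.
have lhs : (1 - p) * slope (x k.+1) @[k --> \oo] --> (1 - p) * slope 0.
  by apply: cvgMr; apply: (cvg_slope _ gam_gt0) => //; rewrite (cvg_shiftS x).
have rhs : slope (x k) - p * slope (leftover B x k.+1 / w%:R) @[k --> \oo]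
    --> slope 0 - p * slope (s / w%:R).
  apply: cvgB; first exact: (cvg_slope _ gam_gt0).
  by apply: cvgMr; apply: (cvg_slope _ gam_gt0); [rewrite divr_ge0 // ltW|exact: cvgMl].
have e : (1 - p) * slope 0 = slope 0 - p * slope (s / w%:R).
  by rewrite -(cvg_lim _ lhs) // -(cvg_lim _ rhs) // (funext x_rec).
have : s / w%:R = 0.
  apply: (slope_inj _ gam_gt0) => //; first by rewrite divr_ge0 // ltW.
  apply: (mulfI (lt0r_neq0 p_gt0)).
  by move: e; rewrite slope0; lra.
by move=> /eqP; rewrite mulf_eq0 invr_eq0 (gt_eqF wR_gt0) orbF => /eqP <-.
Qed.

Lemma leftover_arbitrarily_small c : (forall m, c <= leftover B x m.+1) -> c <= 0.
Proof.
move=> cl; have h : leftover B x m.+1 @[m --> \oo] --> 0.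
  by rewrite (cvg_shiftS (leftover B x)); exact: cvg_leftover.
rewrite -(cvg_lim _ h) //; apply: limr_ge; first exact: cvgP h.
exact: nearW.
Qed.

Lemma recursion_sum : (\sum_(k <oo) (x k)%:E)%E = B%:E.
Proof.
have cs : series x @ \oo --> B.
  rewrite (_ : series x = fun n => B - leftover B x n).
    by rewrite -[X in _ --> X]subr0; apply: cvgB; [exact: cvg_cst|exact: cvg_leftover].
  by apply/funext => n; rewrite /leftover subKr /series /= big_mkord.
by rewrite nneseries_series; [rewrite (cvg_lim _ cs)|exact: cvgP cs].
Qed.

Hypothesis x_gt0 : forall k, 0 < x k.

(* Otherwise the sequence would be nondecreasing from [k] on, and not summable. *)
Lemma recursion_lt_share k : x k < leftover B x k.+1 / w%:R.
Proof.
rewrite ltNge; apply/negP => h.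
(* A share at most [x (k + i)] has the larger slope, so the recursion makes the next term no
   smaller, while shares only shrink. *)
have up i : leftover B x (k + i).+1 / w%:R <= x (k + i) /\ x k <= x (k + i).
  elim: i => [|i [IH1 IH2]]; first by rewrite addn0.
  have le : x (k + i) <= x (k + i).+1.
    rewrite leNgt -(ltr_slope _ gam_gt0) // -leNgt -(ler_pM2l q_gt0) x_rec.
    rewrite (mulrBl (slope _)) mul1r lerD2l lerN2 ler_pM2l //.
    by rewrite leNgt ltr_slope // -leNgt.
  rewrite addnS; split; last exact: le_trans le.
  rewrite (le_trans _ le) // (le_trans _ IH1) // ler_pM2r ?invr_gt0 //.
  by rewrite leftoverS gerBl.
have : x k <= 0; last by rewrite leNgt x_gt0.
apply: leftover_arbitrarily_small => m.
have [mk|km] := leqP m.+1 k.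
  apply: le_trans (x_le_leftover k) _.
  rewrite -(subnKC mk); elim: (k - m.+1)%N => [|j IH]; first by rewrite addn0.
  by rewrite addnS leftoverS (le_trans _ IH) // gerBl.
by rewrite -(subnKC (ltnW km)); apply: le_trans (x_le_leftover _); case: (up (m.+1 - k)%N).
Qed.

Lemma recursion_decreasing k : x k.+1 < x k.
Proof.
rewrite -(ltr_slope _ gam_gt0) // -(ltr_pM2l q_gt0) x_rec (mulrBl (slope _)) mul1r ltrD2l ltrN2.
by rewrite ltr_pM2l // ltr_slope // recursion_lt_share.
Qed.

End Recursion.

(* The recursion propagates a larger first term to every later term, and hence to
   the total energy. *)
Lemma recursion_ge_first x y : feasible_seq x -> feasible_seq y ->
  balanced x -> balanced y ->
  y 0%N <= x 0%N.
Proof.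
move=> fx fy rx ry; rewrite -subr_le0.
rewrite leNgt subr_gt0; apply/negP => xy0.
have up k : x k < y k /\ leftover B y k.+1 <= leftover B x k.+1 - (y 0%N - x 0%N).
  elim: k => [|k [IH1 IH2]]; first by rewrite !leftoverS !leftover0; split=> //; lra.
  have lt : x k.+1 < y k.+1.
    rewrite -(ltr_slope _ gam_gt0) ?fx.1 ?fy.1 // -(ltr_pM2l q_gt0) rx ry.
    apply: ltrB; first by rewrite ltr_slope ?fx.1 ?fy.1.
    rewrite ltr_pM2l // ltr_slope // ?divr_ge0 ?fx.2 ?fy.2 ?(ltW wR_gt0) //.
    by rewrite ltr_pM2r ?invr_gt0 // (le_lt_trans IH2) // gtrBl subr_gt0.
  by split=> //; rewrite leftoverS [leftover B x _]leftoverS; lra.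
have : y 0%N - x 0%N <= 0; last by rewrite leNgt subr_gt0 xy0.
apply: (leftover_arbitrarily_small _ fx rx) => m.
by have [_] := up m; have := fy.2 m.+1; lra.
Qed.

(** Comparing both ways equates the first terms; the recursion then determines each next term, as
    [slope] is injective. *)
Lemma recursion_unique x y : feasible_seq x -> feasible_seq y ->
  balanced x -> balanced y ->
  x = y.
Proof.
move=> fx fy rx ry.
have xy0 : x 0%N = y 0%N.
  by apply/eqP; rewrite eq_le !(recursion_ge_first _ _ fx fy, recursion_ge_first _ _ fy fx).
suff eqk k : x k = y k /\ leftover B x k.+1 = leftover B y k.+1.
  by apply/funext => k; case: (eqk k).
elim: k => [|k [IH1 IH2]]; first by rewrite !leftoverS !leftover0 xy0.
have xyk : x k.+1 = y k.+1.
  apply: (slope_inj _ gam_gt0); [exact: fx.1|exact: fy.1|].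
  by apply: (mulfI (lt0r_neq0 q_gt0)); rewrite rx ry IH1 IH2.
by rewrite leftoverS IH2 xyk -leftoverS.
Qed.

End Maximizer.

(** * Assembly of the four claims *)

Lemma xi_recursionP (R : realType) (p gam B : R) w x : xi_recursion p gam B w x <->
  balanced p gam B w x.
Proof.
by split=> h k; have := h k; rewrite /balanced /slope /leftover mulrAC mulrA.
Qed.

Theorem theorem1 (R : realType) (p gam B : R) (w : nat) (Af : R -> R)
  (hp0 : 0 < p) (hp1 : p < 1) (hgam : 0 < gam) (hB : 0 < B) (hw : (0 < w)%N)
  (hAf : forall b, 0 <= b <= B -> 0 <= Af b <= b)
  (hopt : limn_einf (fun T => (GammaT_det p gam w (stat_pol w B Af) T)%:E)
          = Gamma_star p gam B w) :
  (* (i) *)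
  Gamma_star p gam B w = Tstar p gam B w /\
  (* (ii) *)
  (admissible_seq B (xi B Af) /\ Tinf p gam B w (xi B Af) = Tstar p gam B w /\
   forall x, admissible_seq B x -> Tinf p gam B w x = Tstar p gam B w ->
     x = xi B Af) /\
  (* (iii) *)
  (xi_recursion p gam B w (xi B Af) /\ (\sum_(k <oo) (xi B Af k)%:E = B%:E)%E /\
   forall x : nat -> R, (forall k, 0 <= x k) ->
     xi_recursion p gam B w x -> (\sum_(k <oo) (x k)%:E = B%:E)%E ->
     x = xi B Af) /\
  (* (iv) *)
  (forall k, 0 < xi B Af k) /\ (forall k, xi B Af k.+1 < xi B Af k) /\
  (forall k, xi B Af k < (B - \sum_(i < k.+1) xi B Af i) / w%:R).
Proof.
have fxi : feasible_seq B (xi B Af).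
  by split; [exact: xi_ge0 (ltW hB) hAf|exact: leftover_xi_ge0 (ltW hB) hAf].
have TinfE' y : feasible_seq B y -> Tinf p gam B w y
    = (short_gap_gain p gam B w + limn (series (gain p gam B w y)))%:E.
  by case=> y0 yl; exact: TinfE.
(* The averages of the stationary policy converge, so the lower limit in [hopt] is their limit. *)
have GE : Gamma_star p gam B w = Tinf p gam B w (xi B Af).
  rewrite -hopt TinfE' //; apply: (cvg_limn_einf_sup _).1.
  apply: cvg_EFin; first exact: nearW.
  by apply: cvg_GammaT => //; [exact: fxi.1|exact: fxi.2|exact: stat_pol_state hw (ltW hB) hAf].
(* Every feasible sequence is realized by its charge policy. *)
have Gub y : feasible_seq B y -> (Tinf p gam B w y <= Gamma_star p gam B w)%E.
  move=> fy; rewrite TinfE' //; apply: (@Gamma_star_ge _ _ _ _ _ (charge_pol w B y)).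
    exact: charge_pol_admissible hw fy.1 fy.2.
  by apply: cvg_GammaT => //; [exact: fy.1|exact: fy.2].
have TE : Tstar p gam B w = Tinf p gam B w (xi B Af).
  apply/eqP; rewrite eq_le; apply/andP; split.
    by apply: ge_ereal_sup => _ [y /admissible_seqP fy <-]; rewrite -GE Gub.
  by apply: ereal_sup_ubound; exists (xi B Af) => //; exact/admissible_seqP.
have maxP y : feasible_seq B y -> Tinf p gam B w y = Tinf p gam B w (xi B Af) ->
    maximizer p gam B w y.
  move=> fy yE; split=> // z fz.
  have := Gub z fz; rewrite GE -yE !TinfE' // lee_fin lerD2l.
  exact.
have mxi := maxP _ fxi erefl.
have rec := maximizer_balanced _ _ _ _ hp0 hp1 hgam hB hw _ mxi.
have pos := maximizer_gt0 _ _ _ _ hp0 hp1 hgam hB hw _ mxi.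
split; first by rewrite TE.
split.
  split; first exact/admissible_seqP.
  split=> // y /admissible_seqP fy yE.
  by apply: (maximizer_unique _ _ _ _ hp0 hp1 hgam hB hw) => //; apply: maxP => //; rewrite yE.
split.
  split; first exact/xi_recursionP.
  split; first exact: recursion_sum fxi rec.
  move=> y y0 /xi_recursionP ry yB.
  have fy : feasible_seq B y by apply/admissible_seqP; split=> //; rewrite yB.
  exact: recursion_unique fy fxi ry rec.
split=> //; split.
  exact: recursion_decreasing fxi rec pos.
exact: recursion_lt_share fxi rec pos.
Qed.
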